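(* Let $K'=\{(x,y,z)\in\mathbb{R}^3 : x^2+y^2=(|z|-1)^2,\ |z|\ge 1\}$, a union of non-intersecting translates of $K_-$ and $K_+$. There are $(1,1)$-hyperbolic surfaces in $\mathbb{R}^3$ approaching $K'$ at infinity and not containing any lines.
   Context: $K=\{(x,y,z)\in\mathbb{R}^3 : x^2+y^2=z^2\}$, $K_-=K\cap\{z\le 0\}$ and $K_+=K\cap\{z\ge 0\}$. Surfaces called $(1,1)$-hyperbolic are closed (as subsets of $\mathbb{R}^3$) and without boundary. A smooth connected surface in $\mathbb{R}^3$ (standard Euclidean metric) is $(1,1)$-hyperbolic if its second quadratic form is everywhere nondegenerate and has signature $(1,1)$. The Gauss map of a cooriented surface sends a point to the unit normal vector at that point, in $\mathbb{S}^{2}$. $B_R$ is the closed ball of radius $R$ centered at the origin and $\mathbb{S}^{2}_{R}$ is the sphere of radius $R$ centered at the origin. A surface $M$ approaches a surface $L$ at infinity if for any $\epsilon>0$ there exists $R>0$ such that (1) there is a diffeomorphism $\phi:L\setminus B_R\to M\setminus B_R$ with $\|\phi(x)-x\|<\epsilon$ for any $x\in L\setminus B_{2R}$; and (2) there is a diffeomorphism $\psi$ from the Gauss image of $L\cap\mathbb{S}^{2}_{2R}$ onto the Gauss image of $\phi(L\cap\mathbb{S}^{2}_{2R})\subset M$ such that $\operatorname{dist}(\psi(x),x)<\epsilon$ in the standard metric on $\mathbb{S}^{2}$. *)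

(* Defs.v *)
From HB Require Import structures.
From mathcomp Require Import all_boot all_order all_algebra.
From mathcomp Require Import all_classical all_reals all_analysis.

Set Implicit Arguments.
Unset Strict Implicit.
Unset Printing Implicit Defensive.

Import Order.TTheory GRing.Theory Num.Theory.
Import numFieldNormedType.Exports.

Local Open Scope classical_set_scope.
Local Open Scope ring_scope.

(* The library norm `|_| on 'rV[R]_3 is the sup norm: it gives the topology and
   the derivatives, while all distances below use the Euclidean norm [enorm]. *)
Definition dot (R : realType) (u v : 'rV[R]_3) : R :=
  \sum_(i < 3) u 0 i * v 0 i.

Definition enorm (R : realType) (u : 'rV[R]_3) : R := Num.sqrt (dot u u).

Definition eball (R : realType) (r : R) : set 'rV[R]_3 :=
  [set p | enorm p <= r].

Definition esphere (R : realType) (r : R) : set 'rV[R]_3 :=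
  [set p | enorm p = r].

(* Standard (geodesic) distance on the unit sphere. *)
Definition sphere_dist (R : realType) (u v : 'rV[R]_3) : R := acos (dot u v).

Definition coneK (R : realType) : set 'rV[R]_3 :=
  [set p | p 0 0 ^+ 2 + p 0 1 ^+ 2 = p 0 2%:R ^+ 2].
Arguments coneK : clear implicits.

Definition coneKminus (R : realType) : set 'rV[R]_3 :=
  coneK R `&` [set p | p 0 2%:R <= 0].
Arguments coneKminus : clear implicits.

Definition coneKplus (R : realType) : set 'rV[R]_3 :=
  coneK R `&` [set p | 0 <= p 0 2%:R].
Arguments coneKplus : clear implicits.

Definition coneK' (R : realType) : set 'rV[R]_3 :=
  [set p | p 0 0 ^+ 2 + p 0 1 ^+ 2 = (`|p 0 2%:R| - 1) ^+ 2
           /\ 1 <= `|p 0 2%:R|].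
Arguments coneK' : clear implicits.

Definition translate (R : realType) (a : 'rV[R]_3) (S : set 'rV[R]_3) :
  set 'rV[R]_3 := [set a + p | p in S].

Definition line (R : realType) (p v : 'rV[R]_3) : set 'rV[R]_3 :=
  [set p + t *: v | t in [set: R]].

Definition contains_no_line (R : realType) (S : set 'rV[R]_3) : Prop :=
  forall p v : 'rV[R]_3, v != 0 -> ~ (line p v `<=` S).

(* C^oo on the open set U: every iterated directional derivative exists and is
   differentiable (hence continuous) at every point of U. *)
Definition smooth_on (R : realType) (V W : normedModType R)
    (U : set V) (f : V -> W) : Prop :=
  forall (vs : seq V) (x : V), U x ->
    differentiable (foldr (fun v (g : V -> W) => 'D_v g) f vs) x.

(* Smooth maps and diffeomorphisms between arbitrary subsets of R^3, in the
   usual sense of local smooth extensions; between smooth submanifolds these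
   are the ordinary notions. *)
Definition smooth_map (R : realType) (A : set 'rV[R]_3)
    (f : 'rV[R]_3 -> 'rV[R]_3) : Prop :=
  forall a, A a -> exists (U : set 'rV[R]_3) (F : 'rV[R]_3 -> 'rV[R]_3),
    [/\ open U, U a, smooth_on U F & forall x, A x -> U x -> F x = f x].

Definition diffeo (R : realType) (A B : set 'rV[R]_3)
    (f : 'rV[R]_3 -> 'rV[R]_3) : Prop :=
  exists g : 'rV[R]_3 -> 'rV[R]_3,
    [/\ forall x, A x -> B (f x) /\ g (f x) = x,
        forall y, B y -> A (g y) /\ f (g y) = y,
        smooth_map A f & smooth_map B g].

(* Points near which S is an embedded smooth surface without boundary, i.e. the
   zero set of a submersion. *)
Definition regular_point (R : realType) (S : set 'rV[R]_3) (p : 'rV[R]_3) :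
    Prop :=
  S p /\ exists (U : set 'rV[R]_3) (f : 'rV[R]_3 -> R^o),
    [/\ open U, U p, smooth_on U f,
        forall x, U x -> exists v, 'D_v f x != 0
      & S `&` U = [set x | U x /\ f x = 0]].

Definition smooth_surface (R : realType) (S : set 'rV[R]_3) : Prop :=
  forall p, S p -> regular_point S p.

Definition tangent (R : realType) (S : set 'rV[R]_3) (p : 'rV[R]_3) :
    set 'rV[R]_3 :=
  [set v | exists (I : set R^o) (c : R^o -> 'rV[R]_3),
     [/\ open I, I 0, smooth_on I c, forall t, I t -> S (c t)
       & c 0 = p /\ 'D_1 c 0 = v]].

Definition unit_normal (R : realType) (S : set 'rV[R]_3) (p u : 'rV[R]_3) :
    Prop :=
  enorm u = 1 /\ forall v, tangent S p v -> dot u v = 0.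

(* n plays the role of the Gauss map; its values off the regular points of S
   are irrelevant. *)
Definition coorientation (R : realType) (S : set 'rV[R]_3)
    (n : 'rV[R]_3 -> 'rV[R]_3) : Prop :=
  (forall p, regular_point S p -> unit_normal S p (n p))
  /\ {within [set p | regular_point S p], continuous n}.

(* II_p(v, w) = - <dn_p(v), w>, where n is smooth near p and is a unit normal
   field along the surface. For tangent v it does not depend on the values of n
   off the surface, and replacing n by - n only changes its sign. *)
Definition second_form (R : realType) (n : 'rV[R]_3 -> 'rV[R]_3)
    (p v w : 'rV[R]_3) : R := - dot ('D_v n p) w.

Definition nondegenerate (R : realType) (T : set 'rV[R]_3)
    (B : 'rV[R]_3 -> 'rV[R]_3 -> R) : Prop :=
  forall v, T v -> (forall w, T w -> B v w = 0) -> v = 0.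

(* Some basis of T diagonalizes B with one positive and one negative entry. *)
Definition signature11 (R : realType) (T : set 'rV[R]_3)
    (B : 'rV[R]_3 -> 'rV[R]_3 -> R) : Prop :=
  exists e1 e2 : 'rV[R]_3,
    [/\ T = [set v | exists a b : R, v = a *: e1 + b *: e2],
        forall a b : R, a *: e1 + b *: e2 = 0 -> a = 0 /\ b = 0,
        B e1 e2 = 0 /\ B e2 e1 = 0, 0 < B e1 e1 & B e2 e2 < 0].

Definition hyperbolic_at (R : realType) (S : set 'rV[R]_3) (p : 'rV[R]_3) :
    Prop :=
  exists (U : set 'rV[R]_3) (n : 'rV[R]_3 -> 'rV[R]_3),
    [/\ open U, U p, smooth_on U n,
        forall q, S q -> U q -> unit_normal S q (n q)
      & nondegenerate (tangent S p) (second_form n p)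
        /\ signature11 (tangent S p) (second_form n p)].

Definition hyperbolic11 (R : realType) (M : set 'rV[R]_3) : Prop :=
  [/\ M !=set0, closed M, connected M, smooth_surface M
    & forall p, M p -> hyperbolic_at M p].

(* The Gauss maps refer to coorientations of L and M fixed once and for all,
   before eps. The surface L may have singular points: the diffeomorphism phi
   forces L `\` eball r to be smooth as soon as M is. *)
Definition approaches (R : realType) (M L : set 'rV[R]_3) : Prop :=
  exists nL nM : 'rV[R]_3 -> 'rV[R]_3,
  [/\ coorientation L nL, coorientation M nM &
    forall eps : R, 0 < eps -> exists2 r : R, 0 < r &
    exists phi : 'rV[R]_3 -> 'rV[R]_3,
    [/\ diffeo (L `\` eball r) (M `\` eball r) phi,
        forall x, (L `\` eball (2 * r)) x -> enorm (phi x - x) < eps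
      & exists psi : 'rV[R]_3 -> 'rV[R]_3,
          diffeo (nL @` (L `&` esphere (2 * r)))
                 (nM @` (phi @` (L `&` esphere (2 * r)))) psi
          /\ forall u, (nL @` (L `&` esphere (2 * r))) u ->
               sphere_dist (psi u) u < eps]].

(* Main.v *)
From HB Require Import structures.
Require Import Defs.
From mathcomp Require Import all_boot all_order all_algebra.
From mathcomp Require Import all_classical all_reals all_analysis.
From mathcomp Require Import ring lra.
Set Implicit Arguments.
Unset Strict Implicit.
Unset Printing Implicit Defensive.
Import Order.TTheory GRing.Theory Num.Theory.
Import numFieldNormedType.Exports.
Local Open Scope classical_set_scope.
Local Open Scope ring_scope.

(* Write g = (rho + 1)^2 - z^2, where rho is the distance to the z-axis. The two
   half cones of K' are the level set {g = 0}, and M is the level set {g = 4},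
   the surface of revolution rho = sqrt(z^2 + 4) - 1. The profile is positive
   and strictly convex, so M is a connected surface of negative curvature: the
   Hessian of g is positive on the parallels and negative on the meridians.
   A line in M would make sqrt(z^2 + 4) a polynomial along it.
   Both surfaces have the Gauss map grad g / |grad g|. In terms of
   s = rho + 1/2, a point of {g = 0} has squared norm 2 s^2 + 1/2 and a point of
   {g = 4} has squared norm 2 s^2 - 7/2, so s |-> sqrt(s^2 + 2) in each
   meridian half-plane gives a norm-preserving diffeomorphism phi from K'
   outside a ball onto M outside the same ball. It is close to the identity far
   away, and on the trace of a sphere it acts on the Gauss images by a linear
   map close to the identity. *)

(** * Smooth functions *)

Section near_differentiable.
Context {R : realType} {V W : normedModType R}.

(** The first-order expansion at [x] only sees the germ of the function, so the expansion of [f]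
    serves for [g] with the same differential. *)
Lemma near_eq_differentiable (f g : V -> W) (x : V) :
  (\near x, f x = g x) -> differentiable f x -> differentiable g x.
Proof.
move=> fg dfx; have fgx : f x = g x by exact: nbhs_singleton fg.
have gE : g \o shift x = cst (g x) + 'd f x +o_ 0 id.
  apply/eqaddoP => e e0.
  have /eqaddoP/(_ e e0) fo := diff_locally dfx.
  have fg0 : \forall h \near (0 : V), f (h + x) = g (h + x).
    move: fg; rewrite (near_shift 0 x)/=.
    by apply: filterS => h; rewrite /= subr0.
  near=> h.
  suff -> : (g \o shift x - (cst (g x) + 'd f x)) h =
            (f \o shift x - (cst (f x) + 'd f x)) h by near: h.
  by rewrite !fctE /= fgx; congr (_ - _); rewrite -(near fg0 h).
have dg := diff_unique (diff_continuous dfx) gE.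
by apply/diff_locallyP; rewrite dg; split => //; exact: diff_continuous.
Unshelve. all: by end_near. Qed.

Lemma open_near (U : set V) (P : V -> Prop) (x : V) :
  open U -> U x -> (forall y, U y -> P y) -> \forall y \near x, P y.
Proof. by move=> oU Ux UP; near=> y; apply: UP; near: y; exact: open_nbhs_nbhs.
Unshelve. all: by end_near. Qed.

(** Induction on the list of directions: the iterated derivative stays in the class up to equality
    on [U], and since [U] is open such an equality survives differentiation. *)
Lemma smooth_coind (F : set (V -> W)) (U : set V) (f : V -> W) : open U ->
  (forall f, F f -> forall x, U x -> differentiable f x) ->
  (forall f, F f -> forall v, exists2 g, F g &
     forall x, U x -> 'D_v f x = g x) ->
  F f -> smooth_on U f.
Proof.
move=> oU Fd FD Ff vs.
suff [g Fg Ug] : exists2 g, F g &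
    forall x, U x -> foldr (fun v (g : V -> W) => 'D_v g) f vs x = g x.
  move=> x Ux; apply: (near_eq_differentiable (f := g)); last exact: Fd.
  by apply: (open_near oU Ux) => y Uy; rewrite Ug.
elim: vs => [|v vs [g Fg Ug]]; first by exists f.
have [h Fh Uh] := FD _ Fg v; exists h => // x Ux /=.
by rewrite -Uh//; apply: near_eq_derive; exact: open_near Ug.
Qed.

Lemma smooth_on_diff (U : set V) (f : V -> W) (x : V) :
  smooth_on U f -> U x -> differentiable f x.
Proof. by move=> fU; exact: (fU [::]). Qed.

End near_differentiable.

Lemma differentiable_sqrt {R : realType} (x : R) :
  0 < x -> differentiable (@Num.sqrt R) x.
Proof. by move=> x0; apply/derivable1_diffP; have [] := is_derive1_sqrt x0. Qed.

Lemma is_derive_sqrtf {R : realType} {V : normedModType R}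
    (f : V -> R^o) (x v : V) (df : R^o) :
  differentiable f x -> is_derive x v f df -> 0 < f x ->
  is_derive x v (fun y => Num.sqrt (f y) : R^o) (df / (2 * Num.sqrt (f x))).
Proof.
move=> fx [_ dfE] fx0; have dsx := differentiable_sqrt fx0.
have dc := differentiable_comp fx dsx.
apply: DeriveDef; first exact: diff_derivable.
rewrite (deriveE _ dc) (diff_comp fx dsx) /= -(deriveE _ fx) dfE.
rewrite diff1E//= derive1E derive_sqrt//.
Qed.

(* Up to equality on U, this class is closed under directional derivatives, so
   that its members are smooth on U. *)
Inductive elementary {R : realType} {V : normedModType R} (U : set V) :
    (V -> R^o) -> Prop :=
| elem_cst c : elementary U (fun _ => c)
| elem_lin (f : {linear V -> R^o}) : continuous f -> elementary U f
| elem_add f g : elementary U f -> elementary U g ->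
    elementary U (fun x => f x + g x)
| elem_mul f g : elementary U f -> elementary U g ->
    elementary U (fun x => f x * g x)
| elem_inv f : elementary U f -> (forall x, U x -> f x != 0) ->
    elementary U (fun x => (f x)^-1)
| elem_sqrt f : elementary U f -> (forall x, U x -> 0 < f x) ->
    elementary U (fun x => Num.sqrt (f x)).

Section elementary.
Context {R : realType} {V : normedModType R} (U : set V).
Implicit Types f g : V -> R^o.

Lemma elementary_diff f : elementary U f ->
  forall x, U x -> differentiable f x.
Proof.
elim=> {f}.
- by move=> c x _; exact: differentiable_cst.
- by move=> f cf x _; exact: linear_differentiable.
- move=> f g _ IHf _ IHg x Ux.
  by apply: differentiableD; [exact: IHf|exact: IHg].
- move=> f g _ IHf _ IHg x Ux.
  by apply: differentiableM; [exact: IHf|exact: IHg].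
- by move=> f _ IHf f0 x Ux; apply: differentiableV; [exact: IHf|exact: f0].
- move=> f _ IHf f0 x Ux; apply: differentiable_comp; first exact: IHf.
  exact/differentiable_sqrt/f0.
Qed.

Lemma elementary_derive f (v : V) : elementary U f ->
  exists2 g, elementary U g & forall x, U x -> 'D_v f x = g x.
Proof.
elim=> {f}.
- move=> c; exists (fun=> 0); first exact: elem_cst.
  by move=> x _; exact: derive_cst.
- move=> f cf; exists (fun=> f v); first exact: elem_cst.
  by move=> x _; rewrite deriveE ?diff_lin//; exact: linear_differentiable.
- move=> f g Ef [f' Ef' f'E] Eg [g' Eg' g'E].
  exists (fun x => f' x + g' x); first exact: elem_add.
  move=> x Ux; rewrite -f'E// -g'E//; apply: deriveD.
    exact/diff_derivable/elementary_diff.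
  exact/diff_derivable/elementary_diff.
- move=> f g Ef [f' Ef' f'E] Eg [g' Eg' g'E].
  exists (fun x => f x * g' x + g x * f' x).
    by apply: elem_add; exact: elem_mul.
  move=> x Ux; rewrite -f'E// -g'E//; apply: deriveM.
    exact/diff_derivable/elementary_diff.
  exact/diff_derivable/elementary_diff.
- move=> f Ef [f' Ef' f'E] f0.
  (* The derivative of the inverse, spelled with the constructors of [elementary] only. *)
  exists (fun x => (-1) * ((f x)^-1 * (f x)^-1) * f' x).
    do ![apply: elem_mul => //]; [exact: elem_cst|exact: elem_inv|exact: elem_inv].
  move=> x Ux; rewrite deriveV ?f0// ?f'E//.
    by rewrite mulN1r -invfM -expr2.
  exact/diff_derivable/elementary_diff.
- move=> f Ef [f' Ef' f'E] f0.
  have Es : elementary U (fun x => Num.sqrt (f x)) by exact: elem_sqrt.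
  exists (fun x => f' x * (2 * Num.sqrt (f x))^-1).
    apply: elem_mul => //; apply: elem_inv.
      by apply: elem_mul => //; exact: elem_cst.
    by move=> x Ux; rewrite mulf_neq0 ?pnatr_eq0// gt_eqF// sqrtr_gt0 f0.
  move=> x Ux; have fx := elementary_diff Ef Ux.
  have fd : is_derive x v f (f' x).
    by apply: DeriveDef; [exact: diff_derivable|exact: f'E].
  by have [] := is_derive_sqrtf fx fd (f0 x Ux).
Qed.

Lemma elementary_smooth f : open U -> elementary U f -> smooth_on U f.
Proof.
move=> oU; apply: (smooth_coind (F := elementary U)) => //.
  exact: elementary_diff.
by move=> g Eg v; exact: elementary_derive.
Qed.

Lemma elem_opp f : elementary U f -> elementary U (fun x => - f x).
Proof.
move=> Ef; rewrite (_ : (fun _ => _) = fun x => (-1) * f x).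
  by apply: elem_mul => //; exact: elem_cst.
by apply/funext => x; rewrite mulN1r.
Qed.

Lemma elem_sub f g : elementary U f -> elementary U g ->
  elementary U (fun x => f x - g x).
Proof. by move=> Ef Eg; apply: elem_add => //; exact: elem_opp. Qed.

Lemma elem_sqr f : elementary U f -> elementary U (fun x => f x ^+ 2).
Proof. by move=> Ef; exact: elem_mul. Qed.

Lemma elem_div f g : elementary U f -> elementary U g ->
  (forall x, U x -> g x != 0) -> elementary U (fun x => f x / g x).
Proof. by move=> Ef Eg g0; apply: elem_mul => //; exact: elem_inv. Qed.

End elementary.

Lemma elem_id {R : realType} (U : set R^o) : elementary U (fun t : R^o => t).
Proof.
pose L : {linear R^o -> R^o} := idfun.
have cL : continuous L by move=> x; exact: cvg_id.
exact: elem_lin cL.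
Qed.

(** * Derivation rules for functions written pointwise *)

Section lambda_derive.
Context {R : realType} {V : normedModType R}.
Implicit Types (f g : V -> R^o) (x v : V).

Lemma is_derive_addf f g x v (df dg : R^o) : is_derive x v f df ->
  is_derive x v g dg -> is_derive x v (fun y => f y + g y) (df + dg).
Proof. exact: is_deriveD. Qed.

Lemma is_derive_subf f g x v (df dg : R^o) : is_derive x v f df ->
  is_derive x v g dg -> is_derive x v (fun y => f y - g y) (df - dg).
Proof. exact: is_deriveB. Qed.

Lemma is_derive_mulf f g x v (df dg : R^o) : is_derive x v f df ->
  is_derive x v g dg ->
  is_derive x v (fun y => f y * g y) (f x * dg + g x * df).
Proof. exact: is_deriveM. Qed.

Lemma is_derive_sqrf f x v (df : R^o) : is_derive x v f df ->
  is_derive x v (fun y => f y ^+ 2) (2 * f x * df).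
Proof.
move=> fx; have := is_derive_mulf fx fx.
by rewrite -mulr2n -mulrA mulr_natl.
Qed.

Lemma is_derive_invf f x v (df : R^o) : f x != 0 -> is_derive x v f df ->
  is_derive x v (fun y => (f y)^-1) (- df / f x ^+ 2).
Proof.
move=> f0 [fx fE]; apply: DeriveDef; first exact: derivableV.
by rewrite deriveV// fE -[LHS]/(_ * _) mulrC mulrN mulNr.
Qed.

End lambda_derive.

(** * Coordinates in three-space *)

Section vec3.
Context {R : realType}.
Implicit Types (p u v : 'rV[R]_3) (a b c : R).

Definition vec3 a b c : 'rV[R]_3 := \row_(i < 3) [:: a; b; c]`_i.

Lemma vec3E a b c :
  (vec3 a b c 0 0 = a) * (vec3 a b c 0 1 = b) * (vec3 a b c 0 2%:R = c).
Proof. by rewrite !mxE. Qed.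

Lemma row3P u v :
  u 0 0 = v 0 0 -> u 0 1 = v 0 1 -> u 0 2%:R = v 0 2%:R -> u = v.
Proof.
move=> e0 e1 e2; apply/rowP => -[[|[|[|//]]] i3].
- by rewrite (_ : Ordinal i3 = 0)//; exact/val_inj.
- by rewrite (_ : Ordinal i3 = 1)//; exact/val_inj.
- by rewrite (_ : Ordinal i3 = 2%:R)//; exact/val_inj.
Qed.

Lemma vec3_eta p : vec3 (p 0 0) (p 0 1) (p 0 2%:R) = p.
Proof. by apply: row3P; rewrite vec3E. Qed.

Lemma dotE u v :
  dot u v = u 0 0 * v 0 0 + u 0 1 * v 0 1 + u 0 2%:R * v 0 2%:R.
Proof.
have e1 : lift ord0 ord0 = 1 :> 'I_3 by exact/val_inj.
have e2 : lift ord0 (lift ord0 ord0) = 2%:R :> 'I_3 by exact/val_inj.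
by rewrite /dot !big_ord_recl big_ord0 e1 e2 addr0 addrA.
Qed.

Lemma coord_linear (i : 'I_3) : exists2 L : {linear 'rV[R]_3 -> R^o},
  continuous L & (L : _ -> _) = (fun p => p 0 i).
Proof.
have lin : linear (fun p : 'rV[R]_3 => p 0 i : R^o).
  by move=> k u v; rewrite !mxE.
pose M := GRing.isLinear.Build _ _ _ _ _ lin.
pose L : {linear 'rV[R]_3 -> R^o} :=
  HB.pack (fun p : 'rV[R]_3 => p 0 i : R^o) M.
by exists L => //; exact: coord_continuous.
Qed.

Lemma coord_elem (U : set 'rV[R]_3) (i : 'I_3) :
  elementary U (fun p => p 0 i : R^o).
Proof. by have [L cL <-] := coord_linear i; exact: elem_lin. Qed.

Lemma is_derive_coord (i : 'I_3) p v :
  is_derive p v (fun p : 'rV[R]_3 => p 0 i : R^o) (v 0 i).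
Proof.
have [L cL LE] := coord_linear i.
have dL : differentiable L p by exact: linear_differentiable.
rewrite -LE -[v 0 i]/((fun p => p 0 i : R^o) v) -LE.
by apply: DeriveDef; [exact: diff_derivable|rewrite deriveE// diff_lin].
Qed.

Lemma vec3_sum a b c :
  vec3 a b c = a *: vec3 1 0 0 + b *: vec3 0 1 0 + c *: vec3 0 0 1.
Proof. by apply: row3P; rewrite !mxE/=; ring. Qed.

Context {V : normedModType R}.
Implicit Types f g h : V -> R^o.

Lemma differentiable_vec3 f g h (x : V) : differentiable f x ->
  differentiable g x -> differentiable h x ->
  differentiable (fun x => vec3 (f x) (g x) (h x)) x.
Proof.
move=> fx gx hx.
under eq_fun do rewrite vec3_sum.
by apply: differentiableD; [apply: differentiableD|]; exact: differentiableZl.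
Qed.

Lemma is_derive_vec3 f g h (x v : V) (df dg dh : R^o) : is_derive x v f df ->
  is_derive x v g dg -> is_derive x v h dh ->
  is_derive x v (fun x => vec3 (f x) (g x) (h x)) (vec3 df dg dh).
Proof.
move=> [fx fE] [gx gE] [hx hE].
have d : derivable (fun x => vec3 (f x) (g x) (h x)) x v.
  apply/derivable_mxP => i j; rewrite (ord1 i).
  case: j => -[|[|[|//]]] j3; under eq_fun do rewrite mxE /=; by [].
apply: DeriveDef => //; rewrite derive_mx//.
by apply: row3P; rewrite !mxE /= -?fE -?gE -?hE; under eq_fun do rewrite mxE /=.
Qed.

(** Maps with three elementary coordinates form a class stable under directional derivatives, so
    [smooth_coind] applies. *)
Lemma smooth_vec3 (U : set V) f g h : open U -> elementary U f ->
  elementary U g -> elementary U h ->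
  smooth_on U (fun x => vec3 (f x) (g x) (h x)).
Proof.
move=> oU Ef Eg Eh.
apply: (smooth_coind (F := [set k | exists f g h, [/\ elementary U f,
  elementary U g, elementary U h & k = fun x => vec3 (f x) (g x) (h x)]])) => //.
- move=> _ [f' [g' [h' [Ef' Eg' Eh' ->]]]] x Ux.
  by apply: differentiable_vec3; exact: elementary_diff Ux.
- move=> _ [f' [g' [h' [Ef' Eg' Eh' ->]]]] v.
  have [f1 Ef1 f1E] := elementary_derive v Ef'.
  have [g1 Eg1 g1E] := elementary_derive v Eg'.
  have [h1 Eh1 h1E] := elementary_derive v Eh'.
  exists (fun x => vec3 (f1 x) (g1 x) (h1 x)); first by exists f1, g1, h1.
  move=> x Ux; rewrite -f1E// -g1E// -h1E//.
  by apply: derive_val; apply: is_derive_vec3; apply: derivableP;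
    apply/diff_derivable; exact: elementary_diff Ux.
- by exists f, g, h.
Qed.

End vec3.

(** * Surfaces of revolution *)

Section revolution.
Context {R : realType}.
Implicit Types (p v w : 'rV[R]_3).

Definition rad p : R := Num.sqrt (p 0 0 ^+ 2 + p 0 1 ^+ 2).

Definition off_axis : set 'rV[R]_3 := [set p | 0 < rad p].

Lemma rad_ge0 p : 0 <= rad p. Proof. exact: sqrtr_ge0. Qed.

Lemma rad_sqr p : rad p ^+ 2 = p 0 0 ^+ 2 + p 0 1 ^+ 2.
Proof. by rewrite sqr_sqrtr// addr_ge0// sqr_ge0. Qed.

Lemma rad_stretch (k z : R) p : 0 <= k ->
  rad (vec3 (k * p 0 0) (k * p 0 1) z) = k * rad p.
Proof.
move=> k0; rewrite {1}/rad !vec3E !exprMn -mulrDr -rad_sqr -exprMn.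
by rewrite sqrtr_sqr ger0_norm// mulr_ge0// rad_ge0.
Qed.

Lemma rad_continuous : continuous rad.
Proof.
move=> p; apply: continuous_comp; last exact: sqrt_continuous.
have cc i : {for p, continuous (fun p : 'rV[R]_3 => p 0 i)}.
  exact: coord_continuous.
by apply: continuousD; apply: continuousM; exact: cc.
Qed.

Lemma open_rad_gt (a : R) : open [set p | a < rad p].
Proof.
rewrite (_ : [set _ | _] = rad @^-1` [set x | a < x])//.
apply: open_comp => [p _|]; first exact: rad_continuous.
exact: open_gt.
Qed.

Lemma rad_elem (U : set 'rV[R]_3) : U `<=` off_axis ->
  elementary U (rad : _ -> R^o).
Proof.
move=> Uo; apply: elem_sqrt.
  by apply: elem_add; apply: elem_sqr; exact: coord_elem.
by move=> x /Uo; rewrite /off_axis/= sqrtr_gt0.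
Qed.

Lemma is_derive_rad p v : off_axis p -> is_derive p v (rad : _ -> R^o)
  ((p 0 0 * v 0 0 + p 0 1 * v 0 1) / rad p).
Proof.
move=> p0; apply: is_derive_eq; first apply: is_derive_sqrtf.
- by apply: differentiableD; apply: differentiableM; exact: differentiable_coord.
- apply: is_derive_addf; apply: is_derive_sqrf; exact: is_derive_coord.
- by move: p0; rewrite /off_axis/= sqrtr_gt0.
by rewrite -/(rad p); cbv beta; field; rewrite gt_eqF.
Qed.

(* The function g of the introductory comment. *)
Definition gap p : R := (rad p + 1) ^+ 2 - p 0 2%:R ^+ 2.

(* Half the gradient of gap. *)
Definition grad p : 'rV[R]_3 :=
  vec3 (p 0 0 + p 0 0 / rad p) (p 0 1 + p 0 1 / rad p) (- p 0 2%:R).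

Lemma gap_elem : elementary off_axis (gap : _ -> R^o).
Proof.
apply: elem_sub; apply: elem_sqr; last exact: coord_elem.
by apply: elem_add; [exact: rad_elem|exact: elem_cst].
Qed.

Lemma is_derive_gap p v : off_axis p ->
  is_derive p v (gap : _ -> R^o) (2 * dot (grad p) v).
Proof.
move=> p0; apply: is_derive_eq.
  apply: is_derive_subf; apply: is_derive_sqrf; last exact: is_derive_coord.
  by apply: is_derive_addf; exact: is_derive_rad.
by rewrite dotE !vec3E; cbv beta; field; rewrite gt_eqF.
Qed.

(** Half the Hessian of [gap]: on horizontal vectors it is the identity plus [1 / rad p] times the
    projection onto the direction of the parallel, and it is minus the identity on the vertical. *)
Lemma is_derive_grad p v : off_axis p -> is_derive p v grad
  (let c := (p 0 0 * v 0 0 + p 0 1 * v 0 1) / rad p ^+ 3 in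
   vec3 (v 0 0 + v 0 0 / rad p - c * p 0 0)
        (v 0 1 + v 0 1 / rad p - c * p 0 1) (- v 0 2%:R)).
Proof.
move=> p0; have r0 : rad p != 0 by rewrite gt_eqF.
apply: is_derive_vec3.
- apply: is_derive_eq.
    apply: is_derive_addf; first exact: is_derive_coord.
    apply: is_derive_mulf; first exact: is_derive_coord.
    by apply: is_derive_invf => //; exact: is_derive_rad.
  by cbv beta; field.
- apply: is_derive_eq.
    apply: is_derive_addf; first exact: is_derive_coord.
    apply: is_derive_mulf; first exact: is_derive_coord.
    by apply: is_derive_invf => //; exact: is_derive_rad.
  by cbv beta; field.
- exact/is_deriveN/is_derive_coord.
Qed.

(** The norm of [grad] off the axis, in a form that is positive everywhere. *)
Definition slope p : R := Num.sqrt ((rad p + 1) ^+ 2 + p 0 2%:R ^+ 2).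

Definition gauss p : 'rV[R]_3 := (slope p)^-1 *: grad p.

End revolution.

(** * Normals and tangent planes of the level sets *)

Section level_sets.
Context {R : realType}.
Implicit Types (p v w : 'rV[R]_3) (S : set 'rV[R]_3) (k : R).

Definition level k : set 'rV[R]_3 := [set p | gap p = k].

Lemma slope_gt0 p : 0 < slope p.
Proof.
by rewrite sqrtr_gt0 ltr_wpDr ?sqr_ge0// exprn_gt0// ltr_wpDl ?rad_ge0.
Qed.

Lemma slope_sqr p : slope p ^+ 2 = (rad p + 1) ^+ 2 + p 0 2%:R ^+ 2.
Proof. by rewrite sqr_sqrtr// addr_ge0// sqr_ge0. Qed.

Lemma dotZl (a : R) v w : dot (a *: v) w = a * dot v w.
Proof. by rewrite !dotE !mxE; ring. Qed.

Lemma dotDl v v' w : dot (v + v') w = dot v w + dot v' w.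
Proof. by rewrite !dotE !mxE; ring. Qed.

Lemma dotC v w : dot v w = dot w v.
Proof. by rewrite !dotE; ring. Qed.

Lemma dot_grad p : off_axis p -> dot (grad p) (grad p) = slope p ^+ 2.
Proof.
move=> p0; have r0 : rad p != 0 by rewrite gt_eqF.
rewrite slope_sqr dotE !vec3E -[p 0 2%:R ^+ 2]mulrNN; congr (_ + _).
(* The horizontal part of [grad p] is [1 + 1 / rad p] times that of [p]. *)
transitivity (rad p ^+ 2 * (1 + (rad p)^-1) ^+ 2); last by field.
by rewrite rad_sqr; ring.
Qed.

Lemma enorm_gauss p : off_axis p -> enorm (gauss p) = 1.
Proof.
move=> p0; have s0 := slope_gt0 p.
rewrite /enorm dotZl dotC dotZl dot_grad// (_ : _ * _ = 1) ?sqrtr1//.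
by field; rewrite gt_eqF.
Qed.

(** [gap] is constant along a curve in [S]; the chain rule at time 0 gives the orthogonality. *)
Lemma tangent_level S k p v : S `<=` level k -> off_axis p ->
  tangent S p v -> dot (grad p) v = 0.
Proof.
move=> Sk p0 [I [c [oI I0 sc cS [c0 cv]]]].
have dc := smooth_on_diff sc I0.
have [dgap gapE] := is_derive_gap v p0.
have dg : differentiable (gap : _ -> R^o) (c 0).
  by rewrite c0; apply: elementary_diff p0; exact: gap_elem.
have : 'D_1 ((gap : _ -> R^o) \o c) 0 = 0.
  rewrite (near_eq_derive (g := cst k)) ?derive_cst//.
  by apply: (open_near oI I0) => t /cS /Sk.
rewrite deriveE; last exact: differentiable_comp.
rewrite diff_comp//= -(deriveE _ dc) cv -deriveE// c0 gapE.
by move/eqP; rewrite mulf_eq0 pnatr_eq0/= => /eqP.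
Qed.

Lemma unit_normal_gauss S k p : S `<=` level k -> off_axis p ->
  unit_normal S p (gauss p).
Proof.
move=> Sk p0; split; first exact: enorm_gauss.
by move=> v /(tangent_level Sk p0); rewrite dotZl => ->; rewrite mulr0.
Qed.

Lemma slope_elem : elementary off_axis (slope : 'rV[R]_3 -> R^o).
Proof.
apply: elem_sqrt => [|p _]; last by have := slope_gt0 p; rewrite sqrtr_gt0.
apply: elem_add; apply: elem_sqr; last exact: coord_elem.
by apply: elem_add; [exact: rad_elem|exact: elem_cst].
Qed.

Lemma smooth_gauss : smooth_on off_axis (gauss : 'rV[R]_3 -> _).
Proof.
rewrite (_ : gauss = fun p => vec3
  ((slope p)^-1 * (p 0 0 + p 0 0 / rad p))
  ((slope p)^-1 * (p 0 1 + p 0 1 / rad p)) ((slope p)^-1 * (- p 0 2%:R))).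
  have Es : elementary off_axis (fun p : 'rV[R]_3 => (slope p)^-1 : R^o).
    by apply: elem_inv => [|p _]; [exact: slope_elem|rewrite gt_eqF ?slope_gt0].
  have Er i : elementary off_axis (fun p : 'rV[R]_3 => p 0 i + p 0 i / rad p : R^o).
    apply: elem_add; first exact: coord_elem.
    apply: elem_div; [exact: coord_elem|exact: rad_elem|].
    by move=> p p0; rewrite gt_eqF.
  apply: smooth_vec3; [exact: open_rad_gt| | |]; apply: elem_mul => //.
  exact/elem_opp/coord_elem.
by apply/funext => p; apply: row3P; rewrite /gauss /grad !mxE.
Qed.

Lemma continuous_gauss p : off_axis p -> {for p, continuous gauss}.
Proof.
by move=> p0; exact/differentiable_continuous/(smooth_on_diff smooth_gauss).
Qed.

(** In the Leibniz rule, the term that differentiates the factor [1 / slope] is a multiple of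
    [grad p], which is orthogonal to [w]. The second form is thus the Hessian of [gap] up to a
    factor of constant sign. *)
Lemma derive_gauss p v w : off_axis p -> dot (grad p) w = 0 ->
  dot ('D_v gauss p) w = (slope p)^-1 * dot ('D_v grad p) w.
Proof.
move=> p0 pw; have [dgrad _] := is_derive_grad v p0.
have ds : derivable (fun q => (slope q)^-1 : R^o) p v.
  apply/diff_derivable/(elementary_diff _ p0)/elem_inv; first exact: slope_elem.
  by move=> q _; rewrite gt_eqF ?slope_gt0.
have E : is_derive p v gauss
  ('D_v (fun q => (slope q)^-1 : R^o) p *: grad p + (slope p)^-1 *: 'D_v grad p).
  have dcoord (i : 'I_3) : derivable (fun q => grad q 0 i : R^o) p v.
    exact: ((derivable_mxP _ _ _).1 dgrad 0 i).
  have -> : gauss = fun q : 'rV[R]_3 => vec3 ((slope q)^-1 * grad q 0 0)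
     ((slope q)^-1 * grad q 0 1) ((slope q)^-1 * grad q 0 2%:R).
    by apply/funext => q; apply: row3P; rewrite /gauss !mxE.
  apply: is_derive_eq.
    by apply: is_derive_vec3; apply: is_derive_mulf; exact: derivableP.
  by rewrite (derive_mx dgrad); apply: row3P; rewrite !mxE/=; cbv beta; ring.
by rewrite derive_val dotDl !dotZl pw mulr0 add0r.
Qed.

(** On the surface [(rad p + 1) ^+ 2] is [z ^+ 2 + 4], hence at least 4: the waist is the unit
    circle. *)
Lemma level4_rad p : level 4 p -> 1 <= rad p.
Proof.
rewrite /level/= /gap; move: (rad p) (p 0 2%:R) (rad_ge0 p) => r z r0 h.
by have := sqr_ge0 z; nra.
Qed.

Lemma level4_off_axis : level 4 `<=` off_axis.
Proof. by move=> p /level4_rad; exact: lt_le_trans. Qed.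

(* Moving p along a straight line and rescaling the horizontal coordinates back
   to the surface gives a curve with the prescribed tangent velocity. *)
Lemma level4_tangent p v : level 4 p -> dot (grad p) v = 0 ->
  tangent (level 4) p v.
Proof.
move=> p4 pv; have p0 := level4_off_axis p4.
have r0 : rad p != 0 by rewrite gt_eqF.
pose q (t : R^o) : 'rV[R]_3 := vec3 (p 0 0 + t * v 0 0) (p 0 1 + t * v 0 1)
  (p 0 2%:R + t * v 0 2%:R).
pose I : set R^o := [set t | 0 < rad (q t)].
(* [s t - 1] is the radius of the surface at the height of [q t]. *)
pose s (t : R^o) : R^o := Num.sqrt ((q t 0 2%:R) ^+ 2 + 4).
pose c (t : R^o) := vec3 ((s t - 1) / rad (q t) * q t 0 0)
  ((s t - 1) / rad (q t) * q t 0 1) (q t 0 2%:R).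
have s_gt0 t : 0 < q t 0 2%:R ^+ 2 + 4 by rewrite ltr_wpDl ?sqr_ge0.
have s1 t : 1 <= s t.
  by rewrite -[1]sqrtr1 ler_sqrt; have := sqr_ge0 (q t 0 2%:R); lra.
have q0 : q 0 = p by rewrite -[RHS]vec3_eta /q !mul0r !addr0.
have Eq (A : set R^o) (i : 'I_3) : elementary A (fun t : R^o => q t 0 i : R^o).
  have Ec j : elementary A (fun t : R^o => p 0 j + t * v 0 j : R^o).
    apply: elem_add; first exact: elem_cst.
    apply: elem_mul; last exact: elem_cst.
    exact: elem_id.
  by case: i => -[|[|[|//]]] i3; under eq_fun do rewrite mxE /=; exact: Ec.
have Erad (A : set R^o) : A `<=` I -> elementary A (fun t : R^o => rad (q t) : R^o).
  move=> AI; apply: elem_sqrt; first by apply: elem_add; exact: elem_sqr.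
  by move=> t /AI; rewrite /I/= sqrtr_gt0.
have oI : open I.
  have cq : continuous q.
    move=> t; apply: differentiable_continuous.
    have eta : q = fun t => vec3 (q t 0 0) (q t 0 1) (q t 0 2%:R).
      by apply/funext => u; rewrite vec3_eta.
    by rewrite eta; apply: differentiable_vec3;
      apply: (@elementary_diff _ _ setT).
  rewrite (_ : I = q @^-1` off_axis)//; apply: open_comp; last exact: open_rad_gt.
  by move=> t _; exact: cq.
have sz t : (s t) ^+ 2 = q t 0 2%:R ^+ 2 + 4 by rewrite sqr_sqrtr// ltW.
have Es : elementary I s.
  apply: elem_sqrt => //; apply: elem_add; last exact: elem_cst.
  exact: elem_sqr.
have I0 : I 0 by rewrite /I/= q0.
have s0 : s 0 = rad p + 1.
  rewrite /s q0 -p4 /gap addrC subrK sqrtr_sqr ger0_norm//.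
  by rewrite addr_ge0// rad_ge0.
exists I, c; split => //.
- have Ef : elementary I (fun t => (s t - 1) / rad (q t) : R^o).
    apply: elem_div; [|exact: Erad|by move=> t It; rewrite gt_eqF].
    by apply: elem_sub => //; exact: elem_cst.
  apply: smooth_vec3 => //.
  + exact: elem_mul Ef (Eq I 0).
  + exact: elem_mul Ef (Eq I 1).
- move=> t It; have rt0 : rad (q t) != 0 by rewrite gt_eqF.
  rewrite /level/= /gap.
  have -> : rad (c t) = s t - 1.
    by rewrite rad_stretch ?divr_ge0 ?subr_ge0 ?rad_ge0// divfK.
  by rewrite subrK sz !vec3E; ring.
- split; first by rewrite /c q0 s0 addrK divff// !mul1r vec3_eta.
  have dq i : is_derive (0 : R^o) (1 : R^o) (fun t => q t 0 i : R^o) (v 0 i).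
    have dj j : is_derive (0 : R^o) (1 : R^o)
        (fun t => p 0 j + t * v 0 j : R^o) (v 0 j).
      apply: (is_derive_eq (is_derive_addf (is_derive_cst _ _ _)
        (is_derive_mulf (is_derive_id _ _) (is_derive_cst _ _ _)))).
      by cbv beta; rewrite mulr0 mulr1 !add0r.
    case: i => -[|[|[|//]]] i3; under eq_fun do rewrite mxE /=.
    - by rewrite (_ : Ordinal i3 = 0); [exact: dj|exact/val_inj].
    - by rewrite (_ : Ordinal i3 = 1); [exact: dj|exact/val_inj].
    - by rewrite (_ : Ordinal i3 = 2%:R); [exact: dj|exact/val_inj].
  have dqd i : differentiable (fun t => q t 0 i : R^o) (0 : R^o).
    exact: (@elementary_diff _ _ setT).
  have ds : is_derive (0 : R^o) (1 : R^o) s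
      (p 0 2%:R * v 0 2%:R / (rad p + 1)).
    apply: (is_derive_eq (is_derive_sqrtf _ (is_derive_addf
      (is_derive_sqrf (dq _)) (is_derive_cst _ _ _)) (s_gt0 0))).
      apply: differentiableD; last exact: differentiable_cst.
      by apply: differentiableM.
    by cbv beta; rewrite -/(s 0) s0 q0; field; rewrite gt_eqF// ltr_wpDl ?rad_ge0.
  have dr : is_derive (0 : R^o) (1 : R^o) (fun t => rad (q t) : R^o)
      ((p 0 0 * v 0 0 + p 0 1 * v 0 1) / rad p).
    apply: (is_derive_eq (is_derive_sqrtf _ (is_derive_addf
      (is_derive_sqrf (dq _)) (is_derive_sqrf (dq _))) _)).
    - by apply: differentiableD; apply: differentiableM.
    - by rewrite -sqrtr_gt0 -/(rad (q 0)) q0.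
    by cbv beta; rewrite -/(rad (q 0)) q0; field; rewrite gt_eqF.
  (* Tangency says that the radius of the surface and that of [q t] have the same derivative at 0.
     The rescaling factor is therefore 1 with zero derivative there, and [c] keeps the velocity [v]
     of the straight line. *)
  have drs : p 0 2%:R * v 0 2%:R / (rad p + 1) =
      (p 0 0 * v 0 0 + p 0 1 * v 0 1) / rad p.
    move: pv; rewrite dotE !vec3E => /eqP.
    rewrite addr_eq0 mulNr opprK => /eqP <-; field.
    by rewrite r0 gt_eqF// ltr_wpDl ?rad_ge0.
  rewrite drs in ds; set d := _ / rad p in ds dr.
  have dc i : is_derive (0 : R^o) (1 : R^o)
      (fun t => (s t - 1) / rad (q t) * q t 0 i : R^o) (v 0 i).
    have q00 : rad (q 0) != 0 by rewrite q0.
    have h := is_derive_mulf (is_derive_mulf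
      (is_derive_subf ds (is_derive_cst (1 : R^o) _ _)) 
      (is_derive_invf (f := fun t : R^o => rad (q t)) q00 dr)) (dq i).
    apply: (is_derive_eq h).
    by cbv beta; rewrite s0 q0 addrK; field.
  by have [_ ->] := is_derive_vec3 (dc 0) (dc 1) (dq 2%:R); rewrite vec3_eta.
Qed.

End level_sets.

Lemma continuous_vec3 {R : realType} {T : topologicalType} (f g h : T -> R) :
  continuous f -> continuous g -> continuous h ->
  continuous (fun x => vec3 (f x) (g x) (h x)).
Proof.
move=> cf cg ch x; under eq_fun do rewrite vec3_sum.
rewrite /continuous_at vec3_sum.
by apply: cvgD; [apply: cvgD|]; apply: cvgZr_tmp; [exact: cf|exact: cg|exact: ch].
Qed.

(** * The level set of value 4 as a hyperbolic surface *)

Section hyperbolic.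
Context {R : realType}.
Implicit Types (p v w : 'rV[R]_3).

Lemma second_form_gauss p v w : off_axis p -> dot (grad p) w = 0 ->
  second_form gauss p v w = - ((slope p)^-1 *
    (let c := (p 0 0 * v 0 0 + p 0 1 * v 0 1) / rad p ^+ 3 in
     (v 0 0 + v 0 0 / rad p - c * p 0 0) * w 0 0
     + (v 0 1 + v 0 1 / rad p - c * p 0 1) * w 0 1 - v 0 2%:R * w 0 2%:R)).
Proof.
move=> p0 pw; rewrite /second_form derive_gauss//.
by have [_ ->] := is_derive_grad v p0; rewrite dotE !vec3E mulNr.
Qed.

Lemma tangent_level4 p : level 4 p ->
  tangent (level 4) p = [set v | dot (grad p) v = 0].
Proof.
move=> p4; apply/seteqP; split=> v; last exact: level4_tangent.
by apply: (tangent_level (k := 4)) => //; exact: level4_off_axis.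
Qed.

Lemma level4_signature p : level 4 p ->
  signature11 (tangent (level 4) p) (second_form gauss p).
Proof.
move=> p4; have p0 := level4_off_axis p4; have s0 := slope_gt0 p.
have r0 : rad p != 0 by rewrite gt_eqF.
have r1 : rad p + 1 != 0 by rewrite gt_eqF// ltr_wpDl ?rad_ge0.
have rE := rad_sqr p.
(* [e1] is along the meridian and [e2] along the parallel; by rotational symmetry they are the
   principal directions. *)
pose e1 := vec3 (p 0 2%:R * p 0 0 / rad p) (p 0 2%:R * p 0 1 / rad p) (rad p + 1).
pose e2 := vec3 (- p 0 1) (p 0 0) 0.
have t1 : dot (grad p) e1 = 0.
  rewrite dotE !vec3E.
  transitivity (p 0 2%:R * (rad p + 1) * ((p 0 0 ^+ 2 + p 0 1 ^+ 2) / rad p ^+ 2 - 1)).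
    by field.
  by rewrite -rE divff ?expf_neq0// subrr mulr0.
have t2 : dot (grad p) e2 = 0 by rewrite dotE !vec3E; ring.
have yE : p 0 1 ^+ 2 = rad p ^+ 2 - p 0 0 ^+ 2 by rewrite rE addrC addKr.
have zE : p 0 2%:R ^+ 2 = (rad p + 1) ^+ 2 - 4 by rewrite -p4 /gap; ring.
exists e1, e2; split.
- rewrite tangent_level4//; apply/seteqP; split=> v /=.
    (* The third coordinate, in which [e2] vanishes, gives the first coefficient; the second is the
       projection onto [e2], whose squared norm is [rad p ^+ 2]. *)
    move=> pv; exists (v 0 2%:R / (rad p + 1)).
    exists ((p 0 0 * v 0 1 - p 0 1 * v 0 0) / rad p ^+ 2).
    (* Tangency determines the radial component of [v] from its vertical one. *)
    have {}pv : p 0 0 * v 0 0 + p 0 1 * v 0 1 =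
        rad p * p 0 2%:R * v 0 2%:R / (rad p + 1).
      move: pv; rewrite dotE !vec3E => /eqP.
      rewrite addr_eq0 mulNr opprK => /eqP pv.
      by rewrite -[rad p * _ * _]mulrA -pv; field; rewrite r0 r1.
    apply: row3P; rewrite !mxE/=.
    + transitivity ((p 0 0 * (rad p * p 0 2%:R * v 0 2%:R / (rad p + 1))
         - p 0 1 * (p 0 0 * v 0 1 - p 0 1 * v 0 0)) / rad p ^+ 2); last first.
        by field; rewrite r0 r1.
      rewrite -pv rE; field.
      by rewrite -rE expf_neq0.
    + transitivity ((p 0 1 * (rad p * p 0 2%:R * v 0 2%:R / (rad p + 1))
         + p 0 0 * (p 0 0 * v 0 1 - p 0 1 * v 0 0)) / rad p ^+ 2); last first.
        by field; rewrite r0 r1.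
      rewrite -pv rE; field.
      by rewrite -rE expf_neq0.
    + by rewrite mulr0 addr0 divfK.
  move=> [a [b ->]]; rewrite dotC dotDl !dotZl ![dot _ (grad p)]dotC t1 t2.
  by rewrite !mulr0 addr0.
- move=> a b /rowP ab; have := ab 2%:R; rewrite !mxE /= mulr0 addr0 => /eqP.
  rewrite mulf_eq0 (negbTE r1) orbF => /eqP a0; split => //.
  (* A nonzero [b] would make [e2] vanish and put [p] on the axis. *)
  have := ab 0; have := ab 1; rewrite a0 !mxE /= !mul0r !add0r => /eqP bx /eqP by_.
  apply/eqP; apply: contraTT p0 => b0; rewrite /off_axis/= /rad.
  move: bx by_; rewrite !mulf_eq0 oppr_eq0 (negbTE b0)/= => /eqP -> /eqP ->.
  by rewrite expr0n/= addr0 sqrtr0 ltxx.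
- split; rewrite second_form_gauss// !vec3E /=; apply/eqP; rewrite oppr_eq0 mulf_eq0.
    by apply/orP; right; apply/eqP; field.
  by apply/orP; right; apply/eqP; field.
- rewrite second_form_gauss// !vec3E /= -mulrN mulr_gt0 ?invr_gt0//.
  (* On the radial part of [e1] the [1 / rad p] term and the [c] term cancel, leaving
     [z ^+ 2 - (rad p + 1) ^+ 2], which is -4 on the surface. *)
  set c := (_ + _) / rad p ^+ 3.
  have -> : c = p 0 2%:R / rad p ^+ 2.
    transitivity (p 0 2%:R * (p 0 0 ^+ 2 + p 0 1 ^+ 2) / rad p ^+ 4).
      by rewrite /c; field.
    by rewrite -rE; field.
  set B := (X in - X).
  have -> : B = p 0 2%:R ^+ 2 * ((p 0 0 ^+ 2 + p 0 1 ^+ 2) / rad p ^+ 2)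
      - (rad p + 1) ^+ 2 by rewrite /B; field.
  by rewrite -rE divff ?expf_neq0// mulr1 zE; lra.
- rewrite second_form_gauss// !vec3E /= oppr_lt0 mulr_gt0 ?invr_gt0//.
  set B := (X in 0 < X).
  have -> : B = (p 0 0 ^+ 2 + p 0 1 ^+ 2) * (1 + (rad p)^-1).
    by rewrite /B; field.
  by rewrite -rE mulr_gt0 ?exprn_gt0// addr_gt0 ?invr_gt0.
Qed.

Lemma hyperbolic_level4 p : level 4 p -> hyperbolic_at (level 4) p.
Proof.
move=> p4; have p0 := level4_off_axis p4.
have [e1 [e2 [TE e12 [B12 B21] B1 B2]]] := level4_signature p4.
exists off_axis, gauss; split => //.
- exact: open_rad_gt.
- exact: smooth_gauss.
- by move=> q _; exact: (unit_normal_gauss (k := 4)).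
split; last by exists e1, e2.
have dg : differentiable gauss p := smooth_on_diff smooth_gauss p0.
(* Nondegeneracy follows from the diagonal form: pairing with [e2] and [e1] kills the two
   coefficients in turn. *)
have Blin a b w : second_form gauss p (a *: e1 + b *: e2) w =
    a * second_form gauss p e1 w + b * second_form gauss p e2 w.
  rewrite /second_form !deriveE// linearD !linearZ dotDl !dotZl; ring.
move=> v; rewrite TE => -[a [b ->]] H.
have T1 : exists a b : R, e1 = a *: e1 + b *: e2.
  by exists 1, 0; rewrite scale1r scale0r addr0.
have T2 : exists a b : R, e2 = a *: e1 + b *: e2.
  by exists 0, 1; rewrite scale1r scale0r add0r.
have := H _ T1; have := H _ T2; rewrite !Blin B12 B21 !mulr0 add0r addr0.
move=> /eqP; rewrite mulf_eq0 (lt_eqF B2) orbF => /eqP ->.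
move=> /eqP; rewrite mulf_eq0 (gt_eqF B1) orbF => /eqP ->.
by rewrite !scale0r addr0.
Qed.

(** * Closedness, smoothness and connectedness of the surface *)

Lemma gap_continuous : continuous (gap : 'rV[R]_3 -> R).
Proof.
have cr : continuous (fun p : 'rV[R]_3 => (rad p + 1) ^+ 2).
  have cr1 : continuous (fun p : 'rV[R]_3 => rad p + 1).
    by move=> p; apply: continuousD; [exact: rad_continuous|exact: cst_continuous].
  by move=> p; exact: (continuous_comp (cr1 p) (@exprn_continuous _ 2%N _)).
have cz : continuous (fun p : 'rV[R]_3 => p 0 2%:R ^+ 2).
  have cc : continuous (fun p : 'rV[R]_3 => p 0 2%:R) by exact: coord_continuous.
  by move=> p; exact: (continuous_comp (cc p) (@exprn_continuous _ 2%N _)).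
by move=> p; exact: continuousB (cr p) (cz p).
Qed.

Lemma closed_level (k : R) : closed (level k).
Proof.
apply: ((continuous_closedP _).1 gap_continuous [set x | x = k]).
exact: closed_eq.
Qed.

Lemma smooth_level4 : smooth_surface (level (4 : R)).
Proof.
move=> p p4; have p0 := level4_off_axis p4; split => //.
exists off_axis, (fun q => gap q - 4); split => //.
- exact: open_rad_gt.
- apply: elementary_smooth; first exact: open_rad_gt.
  by apply: elem_sub; [exact: gap_elem|exact: elem_cst].
(* Along its own half gradient, [gap] has derivative [2 * slope q ^+ 2], which is positive. *)
- move=> q q0; exists (grad q).
  have [_ ->] := is_derive_subf (is_derive_gap (grad q) q0)
    (is_derive_cst (4 : R^o) _ _).
  rewrite subr0 dot_grad// mulf_neq0 ?pnatr_eq0// expf_neq0//.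
  by rewrite gt_eqF// slope_gt0.
- apply/seteqP; split=> q /=.
    by move=> [-> q0]; rewrite subrr.
  by move=> [q0 /eqP]; rewrite subr_eq0 => /eqP.
Qed.

(* Every point of the surface lies on a half parallel that meets the meridian
   y = 0 < x, so that the surface is a union of connected sets with a common
   point. *)
Lemma connected_level4 : connected (level (4 : R)).
Proof.
pose F (z : R) := Num.sqrt (z ^+ 2 + 4) - 1.
have s0 (z : R) : 0 < z ^+ 2 + 4 by rewrite ltr_wpDl ?sqr_ge0.
have F1 (z : R) : 0 < F z.
  by rewrite subr_gt0 -[ltLHS]sqrtr1 ltr_sqrt//; have := sqr_ge0 z; lra.
have lvl (x y z : R) : (x ^+ 2 + y ^+ 2 = F z ^+ 2) -> level 4 (vec3 x y z).
  move=> xy; rewrite /level/= /gap /rad !vec3E xy sqrtr_sqr ger0_norm ?(ltW (F1 z))//.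
  by rewrite subrK sqr_sqrtr ?(ltW (s0 z))//; ring.
have cs : continuous (fun z : R => Num.sqrt (z ^+ 2 + 4)).
  move=> z; apply: continuous_comp; last exact: sqrt_continuous.
  by apply: continuousD; [exact: exprn_continuous|exact: cst_continuous].
have cF : continuous (fun z : R => Num.sqrt (z ^+ 2 + 4) - 1).
  by move=> z; exact: (continuousB (cs z) (@cst_continuous R R 1 z)).
pose mer := [set vec3 (F z) 0 z | z in [set: R]].
(* [t] is the cosine of the angle, and the sign [s] chooses the side of the plane y = 0. *)
pose par (s z : R) :=
  [set vec3 (F z * t) (s * F z * Num.sqrt (1 - t ^+ 2)) z
  | t in `[-1, 1]%classic].
have cmer : connected mer.
  apply: connected_continuous_connected; first exact/connected_intervalP.
  apply: continuous_subspaceT; apply: continuous_vec3.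
  - exact: cF.
  - exact: cst_continuous.
  - by move=> z; exact: cvg_id.
have cpar s z : connected (par s z).
  apply: connected_continuous_connected; first exact: segment_connected.
  apply: continuous_subspaceT; apply: continuous_vec3.
  - move=> t.
    exact: (continuousM (@cst_continuous R R (F z) t) (@cvg_id R (nbhs t))).
  - move=> t; apply: (continuousM (@cst_continuous R R (s * F z) t)).
    apply: continuous_comp; last exact: sqrt_continuous.
    exact: (continuousB (@cst_continuous R R 1 t) (@exprn_continuous R 2%N t)).
  - exact: cst_continuous.
have -> : level 4 = \bigcup_(sz in [set sz : R * R | sz.1 ^+ 2 = 1])
    (mer `|` par sz.1 sz.2).
  apply/seteqP; split=> p.
    move=> p4; have p0 := level4_off_axis p4.
    have rF : rad p = F (p 0 2%:R).
      rewrite /F; apply/eqP; rewrite eq_sym subr_eq; apply/eqP.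
      rewrite -p4 /gap addrC subrK sqrtr_sqr ger0_norm//.
      by rewrite addr_ge0// rad_ge0.
    have r0 : rad p != 0 by rewrite gt_eqF.
    exists (if 0 <= p 0 1 then 1 else -1, p 0 2%:R).
      by rewrite /=; case: ifP; rewrite ?sqrrN expr1n.
    right; exists (p 0 0 / rad p).
      have : `|p 0 0 / rad p| <= 1.
        rewrite normf_div (gtr0_norm p0) ler_pdivrMr// mul1r -sqrtr_sqr.
        by rewrite ler_sqrt ?lerDl ?addr_ge0 ?sqr_ge0.
      by rewrite ler_norml /= in_itv.
    rewrite /= -rF mulrC divfK//.
    have -> : 1 - (p 0 0 / rad p) ^+ 2 = (p 0 1 / rad p) ^+ 2.
      rewrite -(divff (expf_neq0 2 r0)) {1}rad_sqr; field.
      by [].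
    rewrite sqrtr_sqr normf_div (gtr0_norm p0) -[RHS]vec3_eta.
    have -> : (if 0 <= p 0 1 then 1 else -1) * rad p * (`|p 0 1| / rad p) = p 0 1.
      by rewrite {1}leNgt; case: ltP => y0 /=; [rewrite ltr0_norm//|rewrite ger0_norm//];
        field.
    by [].
  move=> [[s z] /= s1 []].
    by move=> [t _ <-]; apply: lvl; rewrite expr0n addr0.
  move=> [t]; rewrite /= in_itv/= -ler_norml => t1 <-; apply: lvl.
  rewrite !exprMn s1 mul1r -mulrDr sqr_sqrtr ?subr_ge0; first by rewrite addrC subrK mulr1.
  by rewrite -real_normK ?num_real// expr_le1.
apply: bigcup_connected.
  by exists (vec3 (F 0) 0 0) => -[s z] _; left; exists 0.
move=> [s z] _; apply: connectedU => //.
exists (vec3 (F z) 0 z); split; first by exists z.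
(* At cosine 1 the half parallel meets the meridian. *)
exists 1; first by rewrite /= in_itv/= lexx andbT; lra.
by rewrite expr1n subrr sqrtr0 mulr0 mulr1.
Qed.

Lemma hyperbolic11_level4 : hyperbolic11 (level (4 : R)).
Proof.
split.
- exists (vec3 1 0 0); rewrite /level/= /gap /rad !vec3E.
  by rewrite expr1n !expr0n/= addr0 sqrtr1; ring.
- exact: closed_level.
- exact: connected_level4.
- exact: smooth_level4.
- exact: hyperbolic_level4.
Qed.

End hyperbolic.

(** * The cone *)

Section cone.
Context {R : realType}.
Implicit Types (p v w : 'rV[R]_3).

(** Both descriptions say that [rad p + 1] is the absolute value of z: two nonnegative numbers with
    equal squares coincide. *)
Lemma coneK'_level : coneK' R = level 0.
Proof.
apply/seteqP; split=> p; rewrite /coneK' /level/= /gap.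
  move=> [xy z1]; rewrite /rad xy sqrtr_sqr ger0_norm ?subr_ge0// subrK.
  by rewrite real_normK ?num_real// subrr.
move/eqP; rewrite subr_eq0 -[p 0 2%:R ^+ 2]real_normK ?num_real//.
rewrite eqrXn2// ?addr_ge0 ?rad_ge0// => /eqP <-.
by rewrite addrK rad_sqr lerDr rad_ge0.
Qed.

Lemma coneK'_translates :
  let a := vec3 0 0 (-1) : 'rV[R]_3 in let b := vec3 0 0 1 in
  coneK' R = translate a (coneKminus R) `|` translate b (coneKplus R)
  /\ translate a (coneKminus R) `&` translate b (coneKplus R) = set0.
Proof.
move=> a b; split; apply/seteqP; split=> p.
- move=> [xy z1]; have [z0|z0] := leP 0 (p 0 2%:R).
    right; exists (p - b); last by rewrite addrC subrK.
    move: xy z1; rewrite ger0_norm// => xy z1.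
    by split; rewrite /coneK/= !mxE /= ?subr0 ?subr_ge0.
  left; exists (p - a); last by rewrite addrC subrK.
  move: xy z1; rewrite ltr0_norm// => xy z1.
  split; rewrite /coneK/= !mxE /= ?opprK ?subr0; last by lra.
  by rewrite xy -sqrrN; congr (_ ^+ 2); ring.
- case=> -[q [qK q0] <-]; rewrite /coneK'/= !mxE /= !add0r; move: qK q0 => /= -> q0.
    by rewrite ler0_norm; [split; [ring|lra]|lra].
  by rewrite ger0_norm; [split; [ring|lra]|lra].
- move=> [[q [_ /= q0] <-] [q' [_ /= q'0]] /(congr1 (fun u : 'rV_3 => u 0 2%:R))].
  by rewrite !mxE /=; lra.
- by [].
Qed.

Lemma level4_no_line : contains_no_line (level (4 : R)).
Proof.
move=> p v; apply: contraNnot => pv.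
(* Subtracting [rad ^+ 2 = x ^+ 2 + y ^+ 2] from [(rad + 1) ^+ 2 = z ^+ 2 + 4] gives [rad + 1 = (z
   ^+ 2 + 5 - x ^+ 2 - y ^+ 2) / 2], a quadratic polynomial in [t] along the line with coefficients
   [c0], [c1], [c2]. *)
pose c0 := (p 0 2%:R ^+ 2 + 5 - p 0 0 ^+ 2 - p 0 1 ^+ 2) / 2.
pose c1 := p 0 2%:R * v 0 2%:R - p 0 0 * v 0 0 - p 0 1 * v 0 1.
pose c2 := (v 0 2%:R ^+ 2 - v 0 0 ^+ 2 - v 0 1 ^+ 2) / 2.
have H (t : R) : (c0 + c1 * t + c2 * t ^+ 2) ^+ 2 =
    (p 0 2%:R + t * v 0 2%:R) ^+ 2 + 4.
  have /pv : line p v (p + t *: v) by exists t.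
  rewrite /level/= /gap; have := rad_sqr (p + t *: v); rewrite !mxE.
  move: (rad _) => r rE gE.
  suff -> : c0 + c1 * t + c2 * t ^+ 2 = r + 1 by rewrite -gE; ring.
  by rewrite /c0 /c1 /c2; lra.
(* Five values determine an identity between polynomials of degree 4; its leading coefficient is
   [c2 ^+ 2]. *)
have [H0 H1 H2] := And3 (H 0) (H 1) (H 2).
have [H3 H4] := conj (H (-1)) (H (-2)).
have c20 : c2 = 0.
  apply/eqP; rewrite -sqrf_eq0; apply/eqP; lra.
move: H0 H1 H2 H3; rewrite c20 !mul0r !addr0 !mulr0 !addr0 => H0 H1 H2 H3.
have e1 : c1 ^+ 2 = v 0 2%:R ^+ 2 by lra.
have e2 : c0 * c1 = p 0 2%:R * v 0 2%:R by lra.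
(* Comparing [(c0 * c1) ^+ 2] with [c0 ^+ 2 * c1 ^+ 2], where [c0 ^+ 2] is [z ^+ 2 + 4] at [p],
   leaves four times the square of the vertical part of [v]. *)
have v2 : v 0 2%:R = 0.
  have : c0 ^+ 2 * c1 ^+ 2 = p 0 2%:R ^+ 2 * v 0 2%:R ^+ 2 by rewrite -!exprMn e2.
  rewrite e1 H0 => h; apply/eqP; rewrite -sqrf_eq0; apply/eqP; lra.
have : v 0 0 ^+ 2 + v 0 1 ^+ 2 = 0.
  by move: c20; rewrite /c2 v2; lra.
move/eqP; rewrite paddr_eq0 ?sqr_ge0// !sqrf_eq0 => /andP[/eqP v0 /eqP v1].
by apply/eqP; apply: row3P; rewrite mxE.
Qed.

(** For a differentiable function a one-sided limit already gives the derivative; a ruling starting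
    at an apex stays on its half cone in one direction only. *)
Lemma derive_ray (f : 'rV[R]_3 -> R^o) p w : differentiable f p ->
  (\forall t \near (0 : R)^'+, f (t *: w + p) = f p) -> 'D_w f p = 0.
Proof.
move=> fp fw; have dfp : derivable f p w by exact: diff_derivable.
rewrite /derive cvg_at_rightE//; apply/lim_near_cst => //.
by apply: filterS fw => t /= ->; rewrite subrr scaler0.
Qed.

(* The rulings of the cone through an apex span the space, so that a function
   vanishing on the cone has zero differential there. *)
Lemma regular_level0 p : regular_point (level 0) p -> off_axis p.
Proof.
move=> [p0 [U [f [oU Up fs fv SU]]]]; rewrite /off_axis/= lt0r rad_ge0 andbT.
apply/negP => /eqP r0.
have df := smooth_on_diff fs Up.
have z1 : p 0 2%:R ^+ 2 = 1.
  by move: p0; rewrite /level/= /gap r0 add0r expr1n => /eqP; rewrite subr_eq0 => /eqP.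
have /eqP : p 0 0 ^+ 2 + p 0 1 ^+ 2 = 0 by rewrite -rad_sqr r0 expr0n.
rewrite paddr_eq0 ?sqr_ge0// !sqrf_eq0 => /andP[/eqP x0 /eqP y0].
have fp q : level 0 q -> U q -> f q = 0.
  move=> q0 Uq; suff [] : [set x | U x /\ f x = 0] q by [].
  by rewrite -SU.
(* The apex has height 1 or -1, so these vectors direct the rulings that leave it. *)
have ray (a b : R) : a ^+ 2 + b ^+ 2 = 1 ->
    'd f p (vec3 a b (p 0 2%:R)) = 0.
  move=> ab; rewrite -deriveE//; apply: derive_ray => //.
  have Uray : \forall t \near (0 : R)^'+, U (t *: vec3 a b (p 0 2%:R) + p).
    have ct : t *: vec3 a b (p 0 2%:R) + p @[t --> (0 : R)] --> p.
      rewrite -[X in _ --> X]add0r -(scale0r (vec3 a b (p 0 2%:R))).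
      by apply: cvgD; [apply: cvgZr_tmp; exact: cvg_id|exact: cvg_cst].
    by apply: cvg_within; apply: ct; exact: open_nbhs_nbhs.
  rewrite (fp p)//; near=> t; apply: fp; last by near: t.
  have t0 : 0 < t by [].
  rewrite /level/= /gap /rad !mxE/= x0 y0 !addr0 !exprMn -mulrDr ab mulr1.
  rewrite sqrtr_sqr gtr0_norm//.
  transitivity ((t + 1) ^+ 2 * (1 - p 0 2%:R ^+ 2)); first by ring.
  by rewrite z1 subrr mulr0.
have [v /negP] := fv _ Up; apply; rewrite deriveE//.
have -> : v = ((v 0 2%:R * p 0 2%:R - v 0 1 + v 0 0) / 2) *: vec3 1 0 (p 0 2%:R)
   + ((v 0 2%:R * p 0 2%:R - v 0 1 - v 0 0) / 2) *: vec3 (-1) 0 (p 0 2%:R)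
   + v 0 1 *: vec3 0 1 (p 0 2%:R).
  apply: row3P; rewrite !mxE/=; [by field|by field|].
  transitivity (v 0 2%:R * p 0 2%:R ^+ 2); last by field.
  by rewrite z1 mulr1.
have r1 : 'd f p (vec3 1 0 (p 0 2%:R)) = 0 by apply: ray; ring.
have r2 : 'd f p (vec3 (-1) 0 (p 0 2%:R)) = 0 by apply: ray; ring.
have r3 : 'd f p (vec3 0 1 (p 0 2%:R)) = 0 by apply: ray; ring.
by rewrite !linearD !linearZ /= r1 r2 r3 !scaler0 !addr0.
Unshelve. all: by end_near. Qed.

End cone.

(** * Asymptotics *)

Section approach.
Context {R : realType}.
Implicit Types (p q u v w : 'rV[R]_3) (r s : R).

(** By [regular_level0] the regular points avoid the apexes, and off the axis [gauss] is a
    continuous unit normal. *)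
Lemma coorientation_level0 : coorientation (level (0 : R)) gauss.
Proof.
split=> [p /regular_level0|]; first exact: (unit_normal_gauss (k := 0)).
apply: continuous_in_subspaceT => p; rewrite inE /= => /regular_level0.
exact: continuous_gauss.
Qed.

Lemma coorientation_level4 : coorientation (level (4 : R)) gauss.
Proof.
have off p : regular_point (level 4) p -> off_axis p.
  by case=> /level4_off_axis.
split=> [p /off|]; first exact: (unit_normal_gauss (k := 4)).
apply: continuous_in_subspaceT => p; rewrite inE /= => /off.
exact: continuous_gauss.
Qed.

(** * A norm-preserving map from the cone to the surface *)

Lemma enorm_sqr p : enorm p ^+ 2 = rad p ^+ 2 + p 0 2%:R ^+ 2.
Proof.
by rewrite rad_sqr /enorm sqr_sqrtr dotE ?addr_ge0// -?expr2 ?sqr_ge0.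
Qed.

Lemma enorm_ge0 p : 0 <= enorm p. Proof. exact: sqrtr_ge0. Qed.

(* [out s] is the radius of the point of the surface that lies on the same
   origin-centered sphere as the points of the cone with radius [s], and
   [height] gives |z| on the surface. *)
Definition out s : R := Num.sqrt ((s + 2^-1) ^+ 2 + 2) - 2^-1.
Definition inw s : R := Num.sqrt ((s + 2^-1) ^+ 2 - 2) - 2^-1.
Definition height s : R := Num.sqrt ((s + 1) ^+ 2 - 4).

Lemma out_sqr s : (out s + 2^-1) ^+ 2 = (s + 2^-1) ^+ 2 + 2.
Proof. by rewrite subrK sqr_sqrtr// addr_ge0// sqr_ge0. Qed.

Lemma out_gt1 s : 0 < s -> 1 < out s.
Proof.
move=> s0; rewrite ltrBrDr -[1 + 2^-1]ger0_norm; last by lra.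
by rewrite -sqrtr_sqr ltr_sqrt; nra.
Qed.

Lemma out_ge s : 0 < s -> s <= out s.
Proof. by move=> s0; have := out_gt1 s0; have := out_sqr s; nra. Qed.

Lemma inw_sqr s : 1 < s -> (inw s + 2^-1) ^+ 2 = (s + 2^-1) ^+ 2 - 2.
Proof. by move=> s1; rewrite subrK sqr_sqrtr//; nra. Qed.

Lemma inw_gt0 s : 1 < s -> 0 < inw s.
Proof.
move=> s1; rewrite subr_gt0 -[ltLHS]ger0_norm; last by lra.
by rewrite -sqrtr_sqr ltr_sqrt; nra.
Qed.

Lemma outK s : 0 < s -> inw (out s) = s.
Proof.
move=> s0; rewrite /inw out_sqr addrK sqrtr_sqr ger0_norm ?addrK//; lra.
Qed.

Lemma inwK s : 1 < s -> out (inw s) = s.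
Proof.
move=> s1; rewrite /out inw_sqr// subrK sqrtr_sqr ger0_norm ?addrK//; lra.
Qed.

Lemma height_sqr s : 1 < s -> height s ^+ 2 = (s + 1) ^+ 2 - 4.
Proof. by move=> s1; rewrite sqr_sqrtr//; nra. Qed.

Lemma height_gt0 s : 1 < s -> 0 < height s.
Proof. by move=> s1; rewrite sqrtr_gt0; nra. Qed.

(** Common shape of [phi], its inverse and the map between Gauss images; composition multiplies the
    factors. *)
Definition stretch (a b : R) p := vec3 (a * p 0 0) (a * p 0 1) (b * p 0 2%:R).

Lemma stretch_stretch a b a' b' p :
  stretch a b (stretch a' b' p) = stretch (a * a') (b * b') p.
Proof. by rewrite /stretch !vec3E !mulrA. Qed.

Lemma stretch1 p : stretch 1 1 p = p.
Proof. by rewrite /stretch !mul1r vec3_eta. Qed.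

(** On the cone the absolute value of z is [rad p + 1], so the two quotients install the new radius
    and height while keeping the angle and the sign of z. *)
Definition phi p :=
  stretch (out (rad p) / rad p) (height (out (rad p)) / (rad p + 1)) p.

Definition phi_inv p :=
  stretch (inw (rad p) / rad p) ((inw (rad p) + 1) / height (rad p)) p.

Lemma rad_phi p : off_axis p -> rad (phi p) = out (rad p).
Proof.
move=> p0; have o1 := out_gt1 p0; rewrite rad_stretch ?divfK ?gt_eqF//.
by rewrite divr_ge0 ?rad_ge0//; lra.
Qed.

Lemma rad_phi_inv p : 1 < rad p -> rad (phi_inv p) = inw (rad p).
Proof.
move=> p1; have o1 := inw_gt0 p1; rewrite rad_stretch ?divfK//.
  by rewrite gt_eqF//; lra.
by rewrite divr_ge0 ?rad_ge0//; lra.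
Qed.

Lemma level0_z p : level 0 p -> p 0 2%:R ^+ 2 = (rad p + 1) ^+ 2.
Proof. by move/eqP; rewrite subr_eq0 => /eqP ->. Qed.

Lemma level4_z p : level 4 p -> p 0 2%:R ^+ 2 = (rad p + 1) ^+ 2 - 4.
Proof. by rewrite /level/= => <-; rewrite /gap; ring. Qed.

Lemma phi_z p : level 0 p -> off_axis p ->
  phi p 0 2%:R ^+ 2 = height (out (rad p)) ^+ 2.
Proof.
move=> p0 pa; rewrite vec3E exprMn level0_z//; field.
by have := rad_ge0 p; lra.
Qed.

Lemma phi_level p : level 0 p -> off_axis p -> level 4 (phi p).
Proof.
move=> p0 pa; rewrite /level/= /gap phi_z// rad_phi// height_sqr ?out_gt1//; ring.
Qed.

Lemma phi_inv_level p : level 4 p -> 1 < rad p -> level 0 (phi_inv p).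
Proof.
move=> p4 p1; have h0 := height_gt0 p1.
rewrite /level/= /gap rad_phi_inv// vec3E exprMn level4_z// -height_sqr//.
by field; rewrite gt_eqF.
Qed.

Lemma phiK p : off_axis p -> phi_inv (phi p) = p.
Proof.
move=> p0; have o1 := out_gt1 p0; have h0 := height_gt0 o1.
rewrite /phi_inv rad_phi// outK// /phi stretch_stretch -[RHS]stretch1.
move: (p0); rewrite /off_axis/= => r0.
congr (stretch _ _ _); field; rewrite ?gt_eqF//; lra.
Qed.

Lemma phi_invK p : 1 < rad p -> phi (phi_inv p) = p.
Proof.
move=> p1; have o1 := inw_gt0 p1; have h0 := height_gt0 p1.
rewrite /phi rad_phi_inv// inwK// /phi_inv stretch_stretch -[RHS]stretch1.
congr (stretch _ _ _); field; rewrite ?gt_eqF//; lra.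
Qed.

Lemma enorm_phi p : level 0 p -> off_axis p -> enorm (phi p) = enorm p.
Proof.
move=> p0 pa; apply/eqP; rewrite -(eqrXn2 (n := 2)) ?enorm_ge0// !enorm_sqr.
rewrite rad_phi// phi_z// height_sqr ?out_gt1// level0_z//.
by apply/eqP; have := out_sqr (rad p); lra.
Qed.

Lemma height_elem (V : normedModType R) (U : set V) (f : V -> R^o) :
  elementary U f -> (forall x, U x -> 1 < f x) ->
  elementary U (fun x => height (f x) : R^o).
Proof.
move=> Ef f1; apply: elem_sqrt => [|x /f1 fx1]; last by nra.
apply: elem_sub; last exact: elem_cst.
by apply: elem_sqr; apply: elem_add => //; exact: elem_cst.
Qed.

Lemma smooth_stretch (U : set 'rV[R]_3) (a b : 'rV[R]_3 -> R^o) : open U ->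
  elementary U a -> elementary U b ->
  smooth_on U (fun p => stretch (a p) (b p) p).
Proof.
by move=> oU Ea Eb; apply: smooth_vec3 => //; apply: elem_mul => //;
  exact: coord_elem.
Qed.

Lemma smooth_phi : smooth_on off_axis phi.
Proof.
have Er : elementary off_axis (rad : 'rV[R]_3 -> R^o) by exact: rad_elem.
have Eo : elementary off_axis (fun p : 'rV[R]_3 => out (rad p) : R^o).
  apply: elem_sub; last exact: elem_cst.
  apply: elem_sqrt => [|p p0]; last by rewrite ltr_wpDl ?sqr_ge0.
  apply: elem_add; last exact: elem_cst.
  by apply: elem_sqr; apply: elem_add => //; exact: elem_cst.
apply: smooth_stretch; first exact: open_rad_gt.
- by apply: elem_div => // p p0; rewrite gt_eqF.
- apply: elem_div.
  + by apply: height_elem => // p; exact: out_gt1.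
  + by apply: elem_add => //; exact: elem_cst.
  + by move=> p _; rewrite gt_eqF// ltr_wpDl ?rad_ge0.
Qed.

Lemma smooth_phi_inv : smooth_on [set p | 1 < rad p] phi_inv.
Proof.
set U := [set p | _].
have U0 : U `<=` off_axis by move=> p; exact: lt_trans.
have Er : elementary U (rad : 'rV[R]_3 -> R^o) by exact: rad_elem.
have Ei : elementary U (fun p : 'rV[R]_3 => inw (rad p) : R^o).
  apply: elem_sub; last exact: elem_cst.
  apply: elem_sqrt => [|p]; last by rewrite /U/= => p1; nra.
  apply: elem_sub; last exact: elem_cst.
  by apply: elem_sqr; apply: elem_add => //; exact: elem_cst.
apply: smooth_stretch; first exact: open_rad_gt.
- by apply: elem_div => // p /U0 p0; rewrite gt_eqF.
- apply: elem_div.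
  + by apply: elem_add => //; exact: elem_cst.
  + exact: height_elem.
  + by move=> p p1; rewrite gt_eqF// height_gt0.
Qed.

(** The cone meets the axis only at its two apexes, which have norm 1. *)
Lemma level0_off_axis p : level 0 p -> 1 < enorm p -> off_axis p.
Proof.
move=> p0 p1; rewrite /off_axis/= lt0r rad_ge0 andbT; apply/eqP => r0.
by have := enorm_sqr p; rewrite level0_z// r0; nra.
Qed.

(** Radius 1 occurs only on the waist, at height 0, where the norm is 1. *)
Lemma level4_rad_gt1 p : level 4 p -> 1 < enorm p -> 1 < rad p.
Proof.
move=> p4 p1; rewrite lt_neqAle level4_rad// andbT; apply/eqP => r1.
by have := enorm_sqr p; rewrite level4_z// -r1; nra.
Qed.

(** As [phi] preserves the norm, it respects complements of balls; [1 <= r] discards the apexes and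
    the waist, where [phi] or its inverse fails to be smooth. *)
Lemma diffeo_phi r : 1 <= r ->
  diffeo (level 0 `\` eball r) (level 4 `\` eball r) phi.
Proof.
move=> r1; have big p : ~ eball r p -> 1 < enorm p.
  by move=> /negP; rewrite -ltNge; exact: le_lt_trans.
have off p : (level 0 `\` eball r) p -> off_axis p.
  by move=> [p0 /big]; exact: level0_off_axis.
have out1 p : (level 4 `\` eball r) p -> 1 < rad p.
  by move=> [p4 /big]; exact: level4_rad_gt1.
exists phi_inv; split.
- move=> p pL; have pa := off _ pL; case: pL => p0 pr; split; last exact: phiK.
  by split; [exact: phi_level|rewrite /eball/= enorm_phi].
- move=> q qM; have q1 := out1 _ qM; case: qM => q4 qr; split; last exact: phi_invK.
  have q0 := phi_inv_level q4 q1; split => //; rewrite /eball/= -enorm_phi ?phi_invK//.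
  by rewrite /off_axis/= rad_phi_inv// inw_gt0.
- move=> p /off pa; exists off_axis, phi; split => //; first exact: open_rad_gt.
  exact: smooth_phi.
- move=> q /out1 q1; exists [set p | 1 < rad p], phi_inv; split => //.
    exact: open_rad_gt.
  exact: smooth_phi_inv.
Qed.

(** * Estimates far from the origin *)

Lemma level0_rad_big r p : 0 < r -> level 0 p -> 2 * r <= enorm p -> r <= rad p + 1.
Proof.
(* The squared norm is [rad p ^+ 2 + (rad p + 1) ^+ 2], at most [2 * (rad p + 1) ^+ 2]. *)
move=> r0 p0 pr; have := enorm_sqr p; rewrite level0_z//; have := rad_ge0 p.
have : (2 * r) ^+ 2 <= enorm p ^+ 2 by rewrite lerXn2r// nnegrE; lra.
move: (rad p) (enorm p) => s e; nra.
Qed.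

Lemma phi_close r p : 1 < r -> level 0 p -> off_axis p -> r <= rad p + 1 ->
  enorm (phi p - p) ^+ 2 * r ^+ 2 <= 8.
Proof.
move=> r1 p0 pa pr.
have o1 := out_gt1 pa; have h0 := height_gt0 o1.
have hE := height_sqr o1; have oE := out_sqr (rad p).
have os := out_ge pa; move: (pa); rewrite /off_axis/= => s0.
have -> : enorm (phi p - p) ^+ 2 = (out (rad p) - rad p) ^+ 2
    + (rad p + 1 - height (out (rad p))) ^+ 2.
  rewrite /enorm sqr_sqrtr; last by rewrite dotE !addr_ge0// -expr2 sqr_ge0.
  pose a := out (rad p) / rad p; pose b := height (out (rad p)) / (rad p + 1).
  transitivity ((a - 1) ^+ 2 * (p 0 0 ^+ 2 + p 0 1 ^+ 2)
      + (b - 1) ^+ 2 * p 0 2%:R ^+ 2).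
    by rewrite dotE !mxE/= -/a -/b; ring.
  rewrite -rad_sqr level0_z// /a /b; field.
  by rewrite !gt_eqF//; lra.
move: (rad p) (out _) (height _) s0 pr o1 h0 hE oE os => s t h s0 pr o1 h0 hE oE os.
(* The horizontal displacement [t - s] and the vertical one [s + 1 - h] are differences of numbers
   whose squares differ by at most 2; dividing by the sums, which are at least [r], bounds each by
   [2 / r]. *)
have ts : (t - s) * (t + s + 1) = 2 by lra.
have sh : (s + 1 - h) * (s + 1 + h) = 2 - (t - s) by lra.
have ts1 : t - s <= 1 by nra.
have sh0 : 0 <= s + 1 - h by rewrite -(pmulr_lge0 _ (_ : 0 < s + 1 + h)); lra.
have A : (t - s) * r <= 2 by nra.
have B : (s + 1 - h) * r <= 2 by nra.
have A0 : 0 <= (t - s) * r by nra.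
have B0 : 0 <= (s + 1 - h) * r by nra.
by rewrite mulrDl -!exprMn; nra.
Qed.

(** The quotient of [slope p] by [slope (phi p)] at a point [p] of the cone of radius [s]. *)
Definition normal_ratio s : R := Num.sqrt ((s + 1) ^+ 2 + (s + 1) ^+ 2)
  / Num.sqrt ((out s + 1) ^+ 2 + height (out s) ^+ 2).

(** [phi] keeps meridian half-planes, so the two normals differ by factors on the horizontal and
    vertical parts. These depend on [rad p] only, hence are constant on the trace of a sphere. *)
Lemma gauss_phi p : level 0 p -> off_axis p ->
  gauss (phi p) = stretch ((out (rad p) + 1) / (rad p + 1) * normal_ratio (rad p))
    (height (out (rad p)) / (rad p + 1) * normal_ratio (rad p)) (gauss p).
Proof.
move=> p0 pa; have s0 := slope_gt0 p; have s1 := slope_gt0 (phi p).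
move: (pa); rewrite /off_axis/= => r0; have o1 := out_gt1 pa.
have -> : normal_ratio (rad p) = slope p / slope (phi p).
  by rewrite /slope level0_z// rad_phi// phi_z.
rewrite /gauss /grad rad_phi//.
apply: row3P; rewrite !mxE/=; field; rewrite ?gt_eqF//; lra.
Qed.

Lemma dot_gauss_phi r p : 1 < r -> level 0 p -> off_axis p -> r <= rad p + 1 ->
  [/\ 0 <= dot (gauss (phi p)) (gauss p), dot (gauss (phi p)) (gauss p) <= 1
    & r ^+ 2 * (1 - dot (gauss (phi p)) (gauss p)) <= 2].
Proof.
move=> r1 p0 pa pr; have s0 := slope_gt0 p; have s1 := slope_gt0 (phi p).
move: (pa); rewrite /off_axis/= => r0; have o1 := out_gt1 pa; have os := out_ge pa.
have h0 := height_gt0 o1; have hE := height_sqr o1.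
have sE : slope p ^+ 2 = 2 * (rad p + 1) ^+ 2 by rewrite slope_sqr level0_z//; ring.
have s'E : slope (phi p) ^+ 2 = (out (rad p) + 1) ^+ 2 + height (out (rad p)) ^+ 2.
  by rewrite slope_sqr rad_phi// phi_z.
have -> : dot (gauss (phi p)) (gauss p) =
    (out (rad p) + 1 + height (out (rad p))) * (rad p + 1)
      / (slope p * slope (phi p)).
  rewrite /gauss dotZl dotC dotZl mulrA -invfM [RHS]mulrC [slope p * _]mulrC.
  congr (_ * _); rewrite /grad rad_phi// dotE !mxE/=.
  transitivity ((out (rad p) + 1) * (rad p + 1) * (p 0 0 ^+ 2 + p 0 1 ^+ 2)
      / rad p ^+ 2 + height (out (rad p)) / (rad p + 1) * p 0 2%:R ^+ 2).
    by field; rewrite !gt_eqF//; lra.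
  by rewrite -rad_sqr level0_z//; field; rewrite !gt_eqF//; lra.
set d := _ / _.
move: (rad p) (out _) (height _) (slope _) (slope _) @d r0 pr o1 os h0 hE sE s'E s0 s1
  => s t h S S' d r0 pr o1 os h0 hE sE s'E s0 s1.
(* [d] is the cosine of the angle between the directions [(t + 1, h)] and [(1, 1)] in a meridian
   plane. *)
have dE : d ^+ 2 * (2 * ((t + 1) ^+ 2 + h ^+ 2)) = (t + 1 + h) ^+ 2.
  rewrite -s'E /d !exprMn exprVn exprMn sE; field.
  by rewrite !gt_eqF//; lra.
have d0 : 0 <= d by rewrite divr_ge0 ?mulr_ge0//; lra.
have d1 : d <= 1.
  rewrite -(ler_sqr (x := d)) ?nnegrE// expr1n.
  rewrite -(ler_pM2r (_ : 0 < 2 * ((t + 1) ^+ 2 + h ^+ 2))); last by nra.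
  by rewrite dE; nra.
split => //.
(* The product of [t + 1 - h] and [t + 1 + h] is 4, and the first factor is the smaller one. *)
have th : (t + 1 - h) ^+ 2 <= 4 by nra.
have dd : (1 - d ^+ 2) * (2 * ((t + 1) ^+ 2 + h ^+ 2)) = (t + 1 - h) ^+ 2.
  by rewrite mulrBl dE; ring.
have rt : r ^+ 2 <= (t + 1) ^+ 2 + h ^+ 2 by nra.
have d2 : 1 - d <= 1 - d ^+ 2 by nra.
have : r ^+ 2 * (1 - d) <= ((t + 1) ^+ 2 + h ^+ 2) * (1 - d ^+ 2).
  by apply: ler_pM => //; [exact: sqr_ge0|lra].
by lra.
Qed.

Lemma diffeo_stretch (A : set 'rV[R]_3) (a b : R) : a != 0 -> b != 0 ->
  diffeo A (stretch a b @` A) (stretch a b).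
Proof.
move=> a0 b0.
have smooth (B : set 'rV[R]_3) c d : smooth_map B (stretch c d).
  move=> p _; exists setT, (stretch c d); split => //; first exact: openT.
  by apply: smooth_stretch; [exact: openT|exact: elem_cst|exact: elem_cst].
exists (stretch a^-1 b^-1); split => //.
- move=> p Ap; split; first by exists p.
  by rewrite stretch_stretch !mulVf// stretch1.
- move=> _ [p Ap <-]; rewrite stretch_stretch !mulVf// stretch1.
  by split.
Qed.

(** Cosine is strictly decreasing on the interval from 0 to pi, which contains [e] because
    [e <= 1]. *)
Lemma sphere_dist_lt (e : R) u v : 0 < e <= 1 -> 0 <= dot u v <= 1 ->
  cos e < dot u v -> sphere_dist u v < e.
Proof.
move=> /andP[e0 e1] /andP[d0 d1]; have pi2 := @pi_ge2 R.
have d_itv : -1 <= dot u v <= 1 by rewrite d1 andbT; lra.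
rewrite /sphere_dist -{1}(acosK (x := dot u v)); last by rewrite in_itv.
rewrite ltr_cos// in_itv/= ?acos_ge0 ?acos_lepi//; lra.
Qed.

Lemma level4_approaches : approaches (level (4 : R)) (level 0).
Proof.
exists gauss, gauss; split; [exact: coorientation_level0|exact: coorientation_level4|].
move=> eps eps0; pose e := Num.min eps 1.
have e0 : 0 < e by rewrite lt_min eps0/=.
have e1 : e <= 1 by rewrite ge_min lexx orbT.
have ee : e <= eps by rewrite ge_min lexx.
have cose : 0 < 1 - cos e.
  rewrite subr_gt0 -cos0 ltr_cos// in_itv/=; have := @pi_ge2 R; lra.
(* The second term makes [r * eps] exceed 3, whose square is above the 8 of [phi_close]; the third
   beats the 2 of [dot_gauss_phi]. *)
pose r := 1 + 3 / eps + 2 / (1 - cos e).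
have r1 : 1 < r by rewrite /r -addrA ltrDl addr_gt0 ?divr_gt0.
have reps : 3 < r * eps.
  have -> : r * eps = 3 + (1 + 2 / (1 - cos e)) * eps.
    by rewrite /r; field; rewrite !gt_eqF.
  by rewrite ltrDl mulr_gt0// addr_gt0 ?divr_gt0.
have rcos : 2 < r ^+ 2 * (1 - cos e).
  have : r * (1 - cos e) = 2 + (1 + 3 / eps) * (1 - cos e).
    by rewrite /r; field; rewrite !gt_eqF.
  have : 0 < (1 + 3 / eps) * (1 - cos e) by rewrite mulr_gt0// addr_gt0 ?divr_gt0.
  move: (_ * (1 - cos e)) => m m0 h; rewrite expr2 -mulrA h; nra.
exists r; first by lra.
have off p : level 0 p -> 2 * r <= enorm p -> off_axis p.
  by move=> p0 pr; apply: level0_off_axis => //; lra.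
exists phi; split.
- by apply: diffeo_phi; exact: ltW.
- move=> p [p0 /negP]; rewrite -ltNge => pr; have pa := off _ p0 (ltW pr).
  have pr1 : r <= rad p + 1 by apply: level0_rad_big (ltW pr) => //; lra.
  have := phi_close r1 p0 pa pr1; have := enorm_ge0 (phi p - p).
  rewrite ltNge; move: (enorm _) => m m0 mr; apply/negP => em.
  have : r * eps <= r * m by rewrite ler_pM2l//; lra.
  by rewrite -exprMn in mr; nra.
(* The radius shared by all points of the cone on the sphere: the positive root of
   [s ^+ 2 + (s + 1) ^+ 2 = (2 * r) ^+ 2]. *)
pose s := Num.sqrt (2 * r ^+ 2 - 4^-1) - 2^-1.
have sE p : level 0 p -> enorm p = 2 * r -> rad p = s.
  move=> p0 pr; have := enorm_sqr p; rewrite pr level0_z// => h.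
  have r0 := rad_ge0 p; rewrite /s.
  have -> : 2 * r ^+ 2 - 4^-1 = (rad p + 2^-1) ^+ 2 by lra.
  by rewrite sqrtr_sqr ger0_norm ?addrK//; lra.
have s0 : 0 < s.
  rewrite subr_gt0 -[ltLHS]ger0_norm; last by lra.
  by rewrite -sqrtr_sqr ltr_sqrt; nra.
pose a := (out s + 1) / (s + 1) * normal_ratio s.
pose b := height (out s) / (s + 1) * normal_ratio s.
have o1 := out_gt1 s0; have h0 := height_gt0 o1.
have n0 : 0 < normal_ratio s.
  by rewrite divr_gt0// sqrtr_gt0 addr_gt0// exprn_gt0//; lra.
have gE p : (level 0 `&` esphere (2 * r)) p ->
    off_axis p /\ gauss (phi p) = stretch a b (gauss p).
  move=> [p0 pr]; have pa : off_axis p by apply: off => //; rewrite pr.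
  by split => //; rewrite gauss_phi// (sE p).
exists (stretch a b); split.
  have -> : gauss @` (phi @` (level 0 `&` esphere (2 * r))) =
      stretch a b @` (gauss @` (level 0 `&` esphere (2 * r))).
    apply/seteqP; split=> _ [_ [p pL <-] <-].
      by exists (gauss p); [exists p|rewrite (gE p pL).2].
    by exists (phi p); [exists p|rewrite (gE p pL).2].
  apply: diffeo_stretch; rewrite gt_eqF// mulr_gt0// divr_gt0//; lra.
move=> _ [p pL <-]; have [pa <-] := gE p pL; case: pL => p0 pr.
have pr1 : r <= rad p + 1 by apply: level0_rad_big => //; [lra|rewrite pr].
have [d0 d1 rd] := dot_gauss_phi r1 p0 pa pr1.
apply: lt_le_trans ee; apply: sphere_dist_lt; [by rewrite e0|by rewrite d0|].
by rewrite ltNge; apply/negP => dc; nra.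
Qed.

End approach.

Theorem theorem3 (R : realType) :
  (exists a b : 'rV[R]_3,
     coneK' R = translate a (coneKminus R) `|` translate b (coneKplus R)
     /\ translate a (coneKminus R) `&` translate b (coneKplus R) = set0)
  /\ exists M : set 'rV[R]_3,
       [/\ hyperbolic11 M, approaches M (coneK' R) & contains_no_line M].
Proof.
split; first by eexists; eexists; exact: coneK'_translates.
exists (level 4); split; first exact: hyperbolic11_level4.
  by rewrite coneK'_level; exact: level4_approaches.
exact: level4_no_line.
Qed.
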